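(* Let $E$ be an integral regular elliptic curve (genus $1$) over $\mathbb{F}_q$, let $\mathbf{n}_{m-1}$ be a tuple of positive integers, $Q=q_{\mathbf{n}_{m-1}}$, and let $a$, $\zeta^*$, $v^*_k$, $\beta^*_n$ be as in the context (assuming $\alpha_0\neq0$). Then, as formal power series in $x$ (the infinite product converging coefficientwise), $$\sum_{n=0}^\infty\beta^*_n\,x^n=\prod_{k=1}^\infty\frac{1-aQ^{-k}x+Q^{1-2k}x^2}{(1-Q^{-k}x)(1-Q^{1-k}x)};$$ equivalently, with $x=Q^{-s}$, $\sum_{n\ge0}\beta^*_nQ^{-ns}=\prod_{k\ge1}\zeta^*(s+k)$. Equivalently again, $\beta^*_n=b_n$ for all $n\ge0$, where $\sum_{n\ge0}b_nx^n=\exp\bigl(\sum_{k\ge1}\frac{N_k}{Q^k-1}\frac{x^k}{k}\bigr)$ with $N_k=Q^k+1-\omega_1^k-\omega_2^k$ and $\omega_1,\omega_2$ the roots of $z^2-az+Q$.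
   Context: Let $\zeta_E(s)=\sum_{D\ge 0}N(D)^{-s}$ be the Artin zeta function of $E$ and $\widehat\zeta_E(s)=\zeta_E(s)$ its complete Artin zeta function (genus $1$). Derived zeta functions are defined recursively (here $g=1$). For the empty tuple $\mathbf{n}_{-1}=()$ put $q_{\mathbf{n}_{-1}}=q$, $T_{\mathbf{n}_{-1}}=q^{-s}$, $\widehat\zeta^{(\mathbf{n}_{-1})}_E=\widehat\zeta_E$. For a tuple $\mathbf{n}_m=(n_0,\dots,n_m)$ of positive integers put $\mathbf{n}_{m-1}=(n_0,\dots,n_{m-1})$, $q_{\mathbf{n}_m}=q^{n_0\cdots n_m}$, $T_{\mathbf{n}_m}=q^{-n_0\cdots n_ms}$; with $\widehat Z^{(\mathbf{n}_{m-1})}_E(T_{\mathbf{n}_{m-1}}):=\widehat\zeta^{(\mathbf{n}_{m-1})}_E(s)$, $\widehat\zeta^{(\mathbf{n}_{m-1})}_E(1):=\operatorname{Res}_{T_{\mathbf{n}_{m-1}}=1}\widehat Z^{(\mathbf{n}_{m-1})}_E$, $\widehat v_N=\prod_{k=1}^N\widehat\zeta^{(\mathbf{n}_{m-1})}_E(k)$, $$\widehat\zeta^{(\mathbf{n}_m)}_E(s)=\sum_{a=1}^{n_m}\Biggl(\sum_{\substack{k_1,\dots,k_p>0\\ \sum k_i=n_m-a}}\frac{\widehat v_{k_1}\cdots\widehat v_{k_p}}{\prod_{j=1}^{p-1}(1-q_{\mathbf{n}_{m-1}}^{k_j+k_{j+1}})}\frac{1}{1-q_{\mathbf{n}_{m-1}}^{n_ms-n_m+a+k_p}}\Biggr)\widehat\zeta^{(\mathbf{n}_{m-1})}_E(n_ms-n_m+a)\Biggl(\sum_{\substack{l_1,\dots,l_r>0\\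 \sum l_i=a-1}}\frac{1}{1-q_{\mathbf{n}_{m-1}}^{-n_ms+n_m-a+1+l_1}}\frac{\widehat v_{l_1}\cdots\widehat v_{l_r}}{\prod_{j=1}^{r-1}(1-q_{\mathbf{n}_{m-1}}^{l_j+l_{j+1}})}\Biggr),$$ inner sums over ordered tuples of positive integers, an empty-composition sum being $1$. For the tuple $\mathbf{n}_{m-1}$, with $Q=q_{\mathbf{n}_{m-1}}$ and $T=Q^{-s}$, one can write $\widehat\zeta^{(\mathbf{n}_{m-1})}_E(s)=\alpha_0\cdot\frac{1-aT+QT^2}{(1-T)(1-QT)}$ with numbers $\alpha_0=\alpha^{(\mathbf{n}_{m-1})}_E(0)$ and $a$. Normalization: $\zeta^*(s):=\frac{1-aT+QT^2}{(1-T)(1-QT)}$, $\zeta^*(1):=\operatorname{Res}_{T=1}\zeta^*=\frac{Q+1-a}{Q-1}$, $v^*_k:=\prod_{j=1}^k\zeta^*(j)$, $\beta^*_0:=1$ and for $n\ge1$ $$\beta^*_n:=\sum_{\substack{k_1,\dots,k_p>0\\k_1+\cdots+k_p=n}}\frac{v^*_{k_1}\cdots v^*_{k_p}}{\prod_{j=1}^{p-1}(1-Q^{k_j+k_{j+1}})},$$ which is the $(\mathbf{n}_{m-1},n)$-derived beta invariant of $E$ computed from the normalized function $\zeta^*$. *)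

(* Defs.v *)
From HB Require Import structures.
From mathcomp Require Import all_boot all_order all_algebra.
From mathcomp Require Import all_classical all_reals all_analysis.
From mathcomp Require Import complex.

Set Implicit Arguments.
Unset Strict Implicit.
Unset Printing Implicit Defensive.

Import Order.TTheory GRing.Theory Num.Theory.
Local Open Scope ring_scope.

(* Formal power series in x, represented by their coefficient sequence *)
(* (coefficient of x^n at index n).                                     *)

Definition ps (R : Type) := nat -> R.

Definition ps_mul (R : comNzRingType) (f g : ps R) : ps R :=
  fun n => \sum_(i < n.+1) f i * g (n - i)%N.

Definition ps_one (R : comNzRingType) : ps R := fun n => (n == 0%N)%:R.

Fixpoint ps_pow (R : comNzRingType) (f : ps R) (m : nat) : ps R :=
  match m with
  | 0 => ps_one R
  | m'.+1 => ps_mul (ps_pow f m') f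
  end.

(* Formal exponential of a power series f with f 0 = 0:
   exp f = sum_m f^m / m!; the coefficient of x^n only involves m <= n. *)
Definition ps_exp (R : fieldType) (f : ps R) : ps R :=
  fun n => \sum_(m < n.+1) (m`!%:R)^-1 * ps_pow f m n.

(* 1/(1 - c x) = sum_n c^n x^n *)
Definition ps_geom (R : comNzRingType) (c : R) : ps R := fun n => c ^+ n.

Definition ps_quad (R : comNzRingType) (c1 c2 : R) : ps R :=
  fun n => match n with 0 => 1 | 1 => c1 | 2 => c2 | _ => 0 end.

(* zeta^*(s) as a function of T = Q^{-s}. *)
Definition zeta_star_T (R : realType) (Q a T : R) : R :=
  (1 - a * T + Q * T ^+ 2) / ((1 - T) * (1 - Q * T)).

(* zeta^*(j) for positive integers j; zeta^*(1) is the residue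
   (Q + 1 - a)/(Q - 1), and for j >= 2 it is the value at T = Q^{-j}. *)
Definition zeta_star_at (R : realType) (Q a : R) (j : nat) : R :=
  if j == 1%N then (Q + 1 - a) / (Q - 1)
  else zeta_star_T Q a ((Q ^+ j)^-1).

Definition v_star (R : realType) (Q a : R) (k : nat) : R :=
  \prod_(1 <= j < k.+1) zeta_star_at Q a j.

Fixpoint seqs_upto (m n : nat) : seq (seq nat) :=
  match m with
  | 0 => [:: [::]]
  | m'.+1 => [::] :: [seq k :: c | k <- iota 1 n, c <- seqs_upto m' n]
  end.

Definition compositions (n : nat) : seq (seq nat) :=
  [seq c <- seqs_upto n n | sumn c == n].

Definition beta_term (R : realType) (Q a : R) (c : seq nat) : R :=
  (\prod_(k <- c) v_star Q a k) /
  \prod_(i < (size c).-1) (1 - Q ^+ (nth 0%N c i + nth 0%N c i.+1)).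

Definition beta_star (R : realType) (Q a : R) (n : nat) : R :=
  if n == 0%N then 1
  else \sum_(c <- compositions n) beta_term Q a c.

Definition prod_factor (R : realType) (Q a : R) (k : nat) : ps R :=
  ps_mul (ps_quad (- (a / Q ^+ k)) (Q / Q ^+ (2 * k)))
         (ps_mul (ps_geom ((Q ^+ k)^-1)) (ps_geom (Q / Q ^+ k))).

Fixpoint partial_prod (R : realType) (Q a : R) (K : nat) : ps R :=
  match K with
  | 0 => ps_one R
  | K'.+1 => ps_mul (partial_prod Q a K') (prod_factor Q a K'.+1)
  end.

Definition N_k (R : realType) (Q : R) (w1 w2 : R[i]) (k : nat) : R[i] :=
  (Q%:C)%C ^+ k + 1 - w1 ^+ k - w2 ^+ k.

Definition log_series (R : realType) (Q : R) (w1 w2 : R[i]) : ps R[i] :=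
  fun k => if k == 0%N then 0
           else N_k Q w1 w2 k / ((Q%:C)%C ^+ k - 1) / k%:R.

Definition b_coeff (R : realType) (Q : R) (w1 w2 : R[i]) : ps R[i] :=
  ps_exp (log_series Q w1 w2).

Definition prime_power (q : nat) : Prop :=
  exists p e : nat, [/\ prime p, (0 < e)%N & q = (p ^ e)%N].

(* Main.v *)
(** For a composition c with first part k, weight the term of beta^*_n by
    1 / (1 - Q^k t); this gives h_n(t), a rational function of t with h_n(0) = beta^*_n
    and h_n(t) = sum_j v^*_j h_(n-j)(Q^j) / (1 - Q^j t).  Put r(t) = 1 - a t + Q t^2.
    The relations
      (1 - Q^n t) h_n(t) = t (1 - Q^(n-1)) h_(n-1)(t) + (1 - t) h_n(t / Q),
      t (1 - Q^n) h_n(t) = (1 - Q^(n-1) t) h_(n-1)(t) - r(t) / (1 - Q t) h_(n-1)(Q t)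
    hold by a mutual induction on n: the residues of the first at t = Q^(-j) are
    instances of the second for h_(n-j) at t = Q^j, and conversely, the link being
    v^*_(j+1) (1 - Q^(j+1)) (1 - Q^j) = v^*_j r(Q^j).  Their terms of order t at t = 0
    combine into a three-term recurrence for beta^*_n, which says that
    B(x) = sum beta^*_n x^n satisfies (1 - x)(1 - Q x) B(Q x) = r(x) B(x).
    Iterating this equation gives the product, and the exponential series satisfies the
    same equation because both sides have the same logarithmic derivative. *)

Require Import Defs.
From HB Require Import structures.
From mathcomp Require Import all_boot all_order all_algebra.
From mathcomp Require Import all_classical all_reals all_analysis.
From mathcomp Require Import complex.
From mathcomp Require Import ring lra zify.
Set Implicit Arguments.
Unset Strict Implicit.
Unset Printing Implicit Defensive.

Import Order.TTheory GRing.Theory Num.Theory.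
Import numFieldNormedType.Exports.
Local Open Scope classical_set_scope.
Local Open Scope ring_scope.

(** * Sums over compositions, split by the first part *)

Lemma sum_seqs_upto (V : nmodType) (m N n : nat) (F : seq nat -> V) :
  (n <= m)%N -> (n <= N)%N -> (0 < n)%N ->
  \sum_(c <- seqs_upto m N | sumn c == n) F c =
  \sum_(1 <= k < n.+1) \sum_(c <- seqs_upto m.-1 N | sumn c == (n - k)%N) F (k :: c).
Proof.
case: m => [|m] /=; first by case: n.
move=> nm nN n0; rewrite big_cons /= eq_sym eqn0Ngt n0 /=.
rewrite big_mkcond big_allpairs_dep /=.
have <- : index_iota 1 N.+1 = iota 1 N by rewrite /index_iota subSS subn0.
rewrite (big_cat_nat (n := n.+1)) //= addrC big_nat_cond big1 ?add0r; last first.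
  by move=> k /andP[/andP[nk _] _]; rewrite big1// => c _; case: eqP => // ?; lia.
apply: eq_big_nat => k /andP[k1 kn]; rewrite -big_mkcond; apply: eq_bigl => c; apply/eqP/eqP; lia.
Qed.

(** Tails produced by [sum_seqs_upto] keep the bounds of the full enumeration, while
    [compositions (n - k)] uses n - k for both; once the bounds reach the sum, their values do not
    matter. *)
Lemma sum_seqs_upto_enough (V : nmodType) (m m' N N' n : nat) (F : seq nat -> V) :
  (n <= m)%N -> (n <= N)%N -> (n <= m')%N -> (n <= N')%N ->
  \sum_(c <- seqs_upto m N | sumn c == n) F c =
  \sum_(c <- seqs_upto m' N' | sumn c == n) F c.
Proof.
elim/ltn_ind: n m m' F => n IH m m' F nm nN nm' nN'.
case: (posnP n) => [n0|n0]; last first.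
  rewrite !sum_seqs_upto//; apply: eq_big_nat => k /andP[k1 kn].
  apply: IH; lia.
rewrite {n IH nm nN nm' nN'}n0.
have E (p M : nat) : \sum_(c <- seqs_upto p M | sumn c == 0%N) F c = F [::].
  case: p => [|p] /=; first by rewrite big_cons big_nil/= addr0.
  rewrite big_cons/= big_mkcond big_allpairs_dep/= big1_seq ?addr0// => k.
  rewrite mem_iota => /andP[_ /andP[k1 _]]; rewrite big1// => c _; case: eqP => // ?; lia.
by rewrite !E.
Qed.

Lemma sum_compositions (V : nmodType) (n : nat) (F : seq nat -> V) :
  (0 < n)%N ->
  \sum_(c <- compositions n) F c =
  \sum_(1 <= k < n.+1) \sum_(c <- compositions (n - k)) F (k :: c).
Proof.
move=> n0; rewrite big_filter sum_seqs_upto//; apply: eq_big_nat => k /andP[k1 kn].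
rewrite big_filter; apply: sum_seqs_upto_enough; lia.
Qed.

(** * The rational functions h_n(t) and the three-term recurrence *)

Section Beta.
Variables (R : realType) (Q a : R).
Hypothesis Q_gt1 : 1 < Q.

Let v := v_star Q a.

(** At t = Q^k this is the factor 1/(1 - Q^(k+l)) gained by prepending k to a composition with first
    part l; the value 1 on the empty composition makes that rule uniform. *)
Definition head_pole (t : R) (c : seq nat) : R :=
  if c is k :: _ then (1 - Q ^+ k * t)^-1 else 1.

Definition beta_fun (n : nat) (t : R) : R :=
  \sum_(c <- compositions n) beta_term Q a c * head_pole t c.

Let h := beta_fun.

Let r (t : R) := 1 - a * t + Q * t ^+ 2.

Lemma Q_neq0 : Q != 0.
Proof. by rewrite gt_eqF// (lt_trans ltr01). Qed.

Lemma exprQ_gt1 k : 1 < Q ^+ k.+1.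
Proof. by rewrite exprn_egt1. Qed.

Lemma exprQ_neq0 k : Q ^+ k != 0.
Proof. by rewrite expf_neq0// Q_neq0. Qed.

Lemma subr_exprQ_neq0 k : 1 - Q ^+ k.+1 != 0.
Proof. by rewrite subr_eq0 eq_sym gt_eqF// exprQ_gt1. Qed.

Lemma v_star1 : v 1 = (Q + 1 - a) / (Q - 1).
Proof. by rewrite /v /v_star big_nat1. Qed.

(** The function zeta^* is invariant under T -> 1/(QT), so its value at T = Q^-(k+2) can be read off
    at T = Q^(k+1), where the numerator is r. Starting at [k.+2] stays clear of the residue at 1. *)
Lemma v_starS k : v k.+2 * ((1 - Q ^+ k.+2) * (1 - Q ^+ k.+1)) = v k.+1 * r (Q ^+ k.+1).
Proof.
rewrite /v /v_star big_nat_recr//= -mulrA; congr (_ * _).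
rewrite /zeta_star_at /= /zeta_star_T /r.
have := subr_exprQ_neq0 k; have := subr_exprQ_neq0 k.+1; have := exprQ_neq0 k.+1.
rewrite (exprS _ k.+1); set y := Q ^+ k.+1 => y0 Qy1 y1; have Q0 := Q_neq0.
field; rewrite ?y0 ?Q0 //= ?mulf_neq0//=.
have -> : y - 1 != 0 by rewrite -oppr_eq0 opprB.
by rewrite -oppr_eq0 opprB Qy1.
Qed.

Lemma beta_term_cons k c :
  beta_term Q a (k :: c) = v k * (beta_term Q a c * head_pole (Q ^+ k) c).
Proof.
rewrite /beta_term; case: c => [|l c] /=.
  by rewrite !big_cons !big_nil !big_ord0 !divr1 !mulr1.
rewrite [in LHS]big_cons big_ord_recl/= invfM -!mulrA; congr (_ * (_ * _)).
by rewrite mulrC exprD [Q ^+ k * _]mulrC.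
Qed.

Lemma beta_fun0 t : h 0 t = 1.
Proof.
rewrite /h /beta_fun big_cons big_nil/= addr0 mulr1 /beta_term big_nil big_ord0.
by rewrite divr1.
Qed.

Lemma beta_funS n t :
  h n.+1 t = \sum_(i < n.+1) v i.+1 * h (n - i) (Q ^+ i.+1) / (1 - Q ^+ i.+1 * t).
Proof.
rewrite /h /beta_fun sum_compositions// big_add1/= big_mkord; apply: eq_bigr => i _.
rewrite mulr_sumr mulr_suml; apply: eq_big_seq => c _.
by rewrite beta_term_cons/=.
Qed.

Lemma beta_fun_at0 n : h n 0 = beta_star Q a n.
Proof.
rewrite /beta_star; case: eqP => [->|/eqP n0]; first exact: beta_fun0.
rewrite /h /beta_fun; apply: eq_big_seq => -[|k c] _ /=; first by rewrite mulr1.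
by rewrite mulr0 subr0 invr1 mulr1.
Qed.

(** The factor 1 - Q^n vanishes at n = 0, the one rank where h is not given by the sum. *)
Lemma beta_fun_tail n t :
  (1 - Q ^+ n) * h n t =
  (1 - Q ^+ n) *
  \sum_(i < n) v i.+1 * h (n - i.+1) (Q ^+ i.+1) / (1 - Q ^+ i.+1 * t).
Proof.
case: n => [|n]; first by rewrite expr0 subrr !mul0r.
by rewrite beta_funS; congr (_ * _); apply: eq_bigr => i _; rewrite subSS.
Qed.

(* [shift_rel] and [contiguous_rel] hold for all t as rational functions; their
   residues at t = Q^-j are instances of each other of smaller rank at t = Q^j. *)
Definition shift_rel (n : nat) := forall k : nat,
  (1 - Q ^+ (n + k).+2) * h n.+1 (Q ^+ k.+1) =
  Q ^+ k.+1 * (1 - Q ^+ n) * h n (Q ^+ k.+1) + (1 - Q ^+ k.+1) * h n.+1 (Q ^+ k).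

Definition contiguous_rel (n : nat) := forall k : nat,
  Q ^+ k.+1 * (1 - Q ^+ n.+1) * h n.+1 (Q ^+ k.+1) =
  (1 - Q ^+ (n + k).+1) * h n (Q ^+ k.+1)
  - r (Q ^+ k.+1) / (1 - Q ^+ k.+2) * h n (Q ^+ k.+2).

(** This is [shift_rel n] multiplied by (1 - t)/t and expanded in partial fractions, a form that
    still makes sense at t = 0. Both sides are compared pole by pole. *)
Lemma shift_partial_fractions n t :
  (forall m, (m < n)%N -> contiguous_rel m) ->
  \sum_(i < n.+1) v i.+1 * h (n - i) (Q ^+ i.+1) *
     ((Q ^+ i.+1 - 1) / (1 - Q ^+ i.+1 * t) - (Q ^+ i - 1) / (1 - Q ^+ i * t)) =
  (1 - Q ^+ n) * h n t - (1 - Q ^+ n.+1) * h n.+1 t.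
Proof.
move=> IH; rewrite beta_fun_tail beta_funS.
under eq_bigr do rewrite mulrBr.
(* The i = 0 term has numerator Q^0 - 1 = 0, so there is no pole at t = 1, and shifting the index
   aligns the poles of the two sums. *)
rewrite sumrB [X in _ - X = _]big_ord_recl/= expr0 subrr mul0r mulr0 add0r.
rewrite !big_ord_recr/= subnn !beta_fun0.
set A := \sum_(i < n) _; set B := \sum_(i < n) _; set C := \sum_(i < n) _.
set D := \sum_(i < n) _.
suff E : A - B = (1 - Q ^+ n) * C - (1 - Q ^+ n.+1) * D.
  by rewrite mulrDr opprD addrA -E; ring.
rewrite /A /B /C /D !mulr_sumr -!sumrB; apply: eq_bigr => -[i i_n] _ /=.
rewrite /bump/= add1n.
have [m nE] : exists m, n = (m + i).+1 by exists (n - i.+1)%N; lia.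
have -> : (n - i = m.+1)%N by lia.
have -> : (n - i.+1 = m)%N by lia.
have := v_starS i; have := IH m ltac:(lia) i; rewrite -nE.
have -> : Q ^+ n.+1 = Q ^+ i.+1 * Q ^+ m.+1 by rewrite -exprD; congr (_ ^+ _); lia.
have := subr_exprQ_neq0 i; have := subr_exprQ_neq0 i.+1.
set y := Q ^+ i.+1; set z := Q ^+ i.+2; set w := (1 - y * t)^-1.
move=> z0 y0 IHm vE.
(* The coefficient identity at the pole t = 1/y: [contiguous_rel m] at y, with r(y) absorbed into
   [v i.+2]. *)
have {}IHm : v i.+1 * (y * (1 - Q ^+ m.+1) * h m.+1 y) =
    v i.+1 * (1 - Q ^+ n) * h m y - v i.+2 * (1 - y) * h m z.
  rewrite IHm mulrBr !mulrA; congr (_ - _ * _); rewrite -vE; field; exact: z0.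
move: IHm => /(congr1 (fun x => x * w)) IHm; lra.
Qed.

(** This is [contiguous_rel n.+1] divided by t: the bracket is the partial fraction expansion of ((1
    - Q^(n+1) t)/(1 - ct) - r(t)/((1 - Qt)(1 - Qct)))/t with c = Q^(i+1). *)
Lemma contiguous_partial_fractions n t :
  (forall k, 1 - Q ^+ k.+1 * t != 0) -> (forall m, (m <= n)%N -> shift_rel m) ->
  \sum_(i < n.+1) v i.+1 * h (n - i) (Q ^+ i.+1) *
    ((Q ^+ i.+1 - Q ^+ n.+1) / (1 - Q ^+ i.+1 * t)
     - ((Q + 1 - a) / (1 - Q ^+ i.+1) / (1 - Q * t)
        + r (Q ^+ i.+1) / (Q ^+ i.+1 - 1) / (1 - Q ^+ i.+2 * t))) =
  (1 - Q ^+ n.+2) * h n.+2 t.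
Proof.
move=> t0 IH; rewrite beta_funS.
under eq_bigr do rewrite mulrBr mulrDr opprD addrA.
rewrite !sumrB.
set A := \sum_(i < n.+1) _; set B := \sum_(i < n.+1) _; set C := \sum_(i < n.+1) _.
set D := \sum_(i < n.+2) _.
have -> : A - B - C = A - (B + C) by ring.
(* Every term of B has its pole at t = 1/Q; their total coefficient (Q + 1 - a) h_(n+1)(1) = (Q - 1)
   v_1 h_(n+1)(1) is the i = 0 term. The terms of C become the later ones through [v_starS]. *)
have -> : B + C = \sum_(i < n.+2)
    (Q ^+ i.+1 - 1) * v i.+1 * h (n.+1 - i) (Q ^+ i) / (1 - Q ^+ i.+1 * t).
  rewrite [RHS]big_ord_recl/= expr0 expr1 subn0 v_star1 beta_funS; congr (_ + _).
    rewrite mulr_sumr mulr_suml; apply: eq_bigr => i _; rewrite mulr1.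
    have := subr_exprQ_neq0 i; have := subr_exprQ_neq0 0; rewrite expr1 => Q1 y1.
    have := t0 0%N; rewrite expr1 => Qt; field.
    by rewrite y1 Qt -oppr_eq0 opprB Q1.
  apply: eq_bigr => i _; rewrite /bump/= add1n subSS.
  have := v_starS i; have := subr_exprQ_neq0 i; have := subr_exprQ_neq0 i.+1.
  move=> z1 y1 vE.
  have -> : r (Q ^+ i.+1) / (Q ^+ i.+1 - 1) / (1 - Q ^+ i.+2 * t) =
   r (Q ^+ i.+1) * ((Q ^+ i.+1 - 1)^-1 / (1 - Q ^+ i.+2 * t)) by rewrite !mulrA.
  set w := (1 - Q ^+ i.+2 * t)^-1.
  have -> : v i.+1 * h (n - i) (Q ^+ i.+1) *
     (r (Q ^+ i.+1) * ((Q ^+ i.+1 - 1)^-1 * w)) =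
     (v i.+1 * r (Q ^+ i.+1)) * (h (n - i) (Q ^+ i.+1) * (Q ^+ i.+1 - 1)^-1 * w).
    by ring.
  rewrite -vE; field.
  by rewrite -oppr_eq0 opprB.
rewrite /D [X in _ = _ * X]big_ord_recr [X in _ - X = _]big_ord_recr/=.
rewrite subnn !beta_fun0 !mulr1.
set E := \sum_(i < n.+1) _; set F := \sum_(i < n.+1) _.
suff H : A - E = (1 - Q ^+ n.+2) * F by rewrite mulrDr -H; ring.
rewrite /A /E /F mulr_sumr -sumrB; apply: eq_bigr => -[i i_n] _ /=.
have [m nE] : exists m, n = (m + i)%N by exists (n - i)%N; lia.
have -> : (n - i = m)%N by lia.
have -> : (n.+1 - i = m.+1)%N by lia.
(* The coefficient identity at t = Q^-(i+1) is [shift_rel m] at Q^(i+1). *)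
have := IH m ltac:(lia) i; rewrite -nE.
have -> : Q ^+ n.+1 = Q ^+ i.+1 * Q ^+ m by rewrite -exprD; congr (_ ^+ _); lia.
rewrite -!mulrA => /(congr1 (fun x => v i.+1 * x / (1 - Q ^+ i.+1 * t))) H.
lra.
Qed.

Lemma contiguous_rel0 : contiguous_rel 0.
Proof.
move=> k; rewrite beta_funS big_ord1/= !beta_fun0 v_star1 expr1 add0n /r.
have := subr_exprQ_neq0 0; have := subr_exprQ_neq0 k.+1; rewrite expr1 (exprS _ k.+1).
set y := Q ^+ k.+1 => Qy1 Q1; field; rewrite Qy1/= -oppr_eq0 opprB Q1//.
Qed.

(** Strong induction closes because each relation of rank n draws on the other one only at ranks
    below n. *)
Lemma shift_and_contiguous_rel n : shift_rel n /\ contiguous_rel n.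
Proof.
elim/ltn_ind: n => n IH; split.
  move=> k; set t := Q ^+ k.+1.
  have t1 j : 1 - Q ^+ j * t != 0 by rewrite -exprD addnS subr_exprQ_neq0.
  have := @shift_partial_fractions n t (fun m mn => (IH m mn).2).
  (* Uses 1/(1 - ct) - 1/(1 - t) = (c - 1) t/((1 - ct)(1 - t)) for c = Q^(i+1) and c = Q^i; the
     terms 1/(1 - t) cancel. *)
  have E : h n.+1 t - h n.+1 (Q ^+ k) =
    t / (1 - t) * (\sum_(i < n.+1) v i.+1 * h (n - i) (Q ^+ i.+1) *
     ((Q ^+ i.+1 - 1) / (1 - Q ^+ i.+1 * t) - (Q ^+ i - 1) / (1 - Q ^+ i * t))).
    rewrite !beta_funS -sumrB mulr_sumr; apply: eq_bigr => i _.
    have := t1 i.+1; have := t1 i; have := t1 0%N; rewrite expr0 mul1r.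
    rewrite /t !exprS; set x := Q ^+ i; set y := Q ^+ k.
    move=> h1 h2 h3; by field; rewrite ?h1 ?h2 ?h3.
  have t1' : 1 - t != 0 by have := t1 0%N; rewrite expr0 mul1r.
  move=> S; move: E; rewrite S => /(congr1 (fun x => x * (1 - t))).
  rewrite [X in _ = X -> _](_ : _ = t * ((1 - Q ^+ n) * h n t - (1 - Q ^+ n.+1) * h n.+1 t)).
    rewrite (_ : Q ^+ (n + k).+2 = Q ^+ n.+1 * t); first by move=> ?; lra.
    by rewrite -exprD; congr (_ ^+ _); lia.
  by field.
(* Rank 0 is separate, since the partial fractions only reach h of rank at least 2. *)
case: n IH => [|n] IH; first by move=> k; exact: contiguous_rel0.
move=> k; set t := Q ^+ k.+1.
have t1 j : 1 - Q ^+ j * t != 0 by rewrite -exprD addnS subr_exprQ_neq0.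
have Qt1 : 1 - Q * t != 0 by have := t1 1%N; rewrite expr1.
have := @contiguous_partial_fractions n t (fun k => t1 _) (fun m mn => (IH m mn).1).
move=> /(congr1 (fun x => t * x)); rewrite mulrA => <-.
rewrite mulr_sumr (exprS _ k.+1) -/t.
rewrite (_ : Q ^+ (n.+1 + k).+1 = Q ^+ n.+1 * t); last by rewrite -exprD addnS.
rewrite !beta_funS !mulr_sumr -sumrB; apply: eq_bigr => i _.
have := t1 i.+2; have := t1 i.+1; have := subr_exprQ_neq0 i.
rewrite (exprS _ i.+1); set x := Q ^+ i.+1 => h1 h2 h3.
rewrite /r; field.
by rewrite mulrCA mulrA h3 Qt1 h2 h1 -oppr_eq0 opprB h1.
Qed.

Lemma beta_star0 : beta_star Q a 0 = 1. Proof. by []. Qed.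

Lemma beta_star1 : beta_star Q a 1 * (Q - 1) = Q + 1 - a.
Proof.
rewrite -beta_fun_at0 beta_funS big_ord1 /= beta_fun0 v_star1 mulr0 subr0 divr1 mulr1.
by rewrite divfK// subr_eq0 gt_eqF.
Qed.

Lemma beta_star_rec n :
  (Q ^+ n.+2 - 1) * beta_star Q a n.+2 =
  (Q ^+ n.+2 + Q ^+ n.+1 - a) * beta_star Q a n.+1
  + (Q - Q ^+ n.+1) * beta_star Q a n.
Proof.
have := @contiguous_partial_fractions n 0 _ (fun m _ => (shift_and_contiguous_rel m).1).
move=> /(_ ltac:(by move=> k; rewrite mulr0 subr0 oner_eq0)).
have := @shift_partial_fractions n 0 (fun m _ => (shift_and_contiguous_rel m).2).
rewrite !beta_fun_at0 => H1 H2.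
(* At t = 0 each bracket of the contiguous sum equals a - Q - Q^(n+1) minus Q times the bracket of
   the shift sum, and the common weights add up to h_(n+1)(0). *)
suff E : Q * ((1 - Q ^+ n) * beta_star Q a n - (1 - Q ^+ n.+1) * beta_star Q a n.+1) =
  - (1 - Q ^+ n.+2) * beta_star Q a n.+2 + (a - Q - Q ^+ n.+1) * beta_star Q a n.+1.
  by rewrite exprS in E *; rewrite (exprS _ n.+1) (exprS _ n) in E *; lra.
rewrite -H1 mulNr -H2 -[in _ * beta_star _ _ n.+1]beta_fun_at0 beta_funS !mulr_sumr.
rewrite -sumrN -big_split/=; apply: eq_bigr => i _.
have := subr_exprQ_neq0 i; rewrite (exprS _ i).
set x := Q ^+ i => h1; rewrite !mulr0 !subr0 !divr1 /r; field.
by rewrite h1 -oppr_eq0 opprB h1.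
Qed.

End Beta.

(** * Algebra of formal power series *)

Section PowerSeries.
Variable R : comNzRingType.
Implicit Types (f g h : ps R) (c u w : R) (n : nat).

(** The substitution f(cx). *)
Definition ps_scale c f : ps R := fun n => c ^+ n * f n.

(** The Euler operator x d/dx. *)
Definition ps_theta f : ps R := fun n => n%:R * f n.

(** Truncation to polynomials lets the ring laws be inherited from [{poly R}]. *)
Lemma coef_ps_mul N f g n : (n < N)%N ->
  ps_mul f g n = ((\poly_(i < N) f i) * (\poly_(i < N) g i))`_n.
Proof.
move=> nN; rewrite coefM; apply: eq_bigr => i _; rewrite !coef_poly.
by rewrite (leq_ltn_trans _ nN) ?(leq_ltn_trans _ nN) ?leq_subr// -ltnS.
Qed.

Lemma ps_mulC f g : ps_mul f g = ps_mul g f.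
Proof. by apply/funext => n; rewrite !(@coef_ps_mul n.+1)// mulrC. Qed.

Lemma ps_mulA f g h : ps_mul f (ps_mul g h) = ps_mul (ps_mul f g) h.
Proof.
apply/funext => n; pose P f := \poly_(i < n.+1) f i : {poly R}.
transitivity (P f * (P g * P h))`_n; [|rewrite mulrA]; rewrite coefM;
  apply: eq_bigr => i _; have i_n : (i < n.+1)%N by [].
  have n_i : (n - i < n.+1)%N by rewrite ltnS leq_subr.
  by rewrite -(coef_ps_mul _ _ n_i) coef_poly i_n.
have n_i : (n - i < n.+1)%N by rewrite ltnS leq_subr.
by rewrite -(coef_ps_mul _ _ i_n) coef_poly n_i.
Qed.

Lemma ps_mul1 f : ps_mul (ps_one R) f = f.
Proof.
apply/funext => n; rewrite /ps_mul big_ord_recl/= mul1r subn0 big1 ?addr0// => i _.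
by rewrite mul0r.
Qed.

Lemma ps_mulDl f g h :
  ps_mul (fun n => f n + g n) h = (fun n => ps_mul f h n + ps_mul g h n).
Proof.
apply/funext => n; rewrite /ps_mul -big_split/=; apply: eq_bigr => i _.
by rewrite mulrDl.
Qed.

Lemma ps_mulZl c f g :
  ps_mul (fun n => c * f n) g = (fun n => c * ps_mul f g n).
Proof.
apply/funext => n; rewrite /ps_mul mulr_sumr; apply: eq_bigr => i _.
by rewrite mulrA.
Qed.

Lemma ps_scaleM c f g :
  ps_scale c (ps_mul f g) = ps_mul (ps_scale c f) (ps_scale c g).
Proof.
apply/funext => n; rewrite /ps_scale /ps_mul mulr_sumr; apply: eq_bigr => i _.
by rewrite mulrACA -exprD subnKC// -ltnS.
Qed.

Lemma ps_thetaM f g : ps_theta (ps_mul f g) =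
  (fun n => ps_mul (ps_theta f) g n + ps_mul f (ps_theta g) n).
Proof.
apply/funext => n; rewrite /ps_theta /ps_mul mulr_sumr -big_split/=.
apply: eq_bigr => i _; rewrite mulrCA -mulrA [f i * (_ * _)]mulrCA -mulrDl -natrD.
by rewrite subnKC ?(mulrCA (f i))// -ltnS.
Qed.

Lemma ps_theta_scale c f : ps_theta (ps_scale c f) = ps_scale c (ps_theta f).
Proof. by apply/funext => n; rewrite /ps_theta /ps_scale mulrCA. Qed.

Lemma ps_quad_mul0 u w f : ps_mul (ps_quad u w) f 0 = f 0.
Proof. by rewrite /ps_mul big_ord1 mul1r. Qed.

Lemma ps_quad_mul1 u w f : ps_mul (ps_quad u w) f 1 = f 1 + u * f 0.
Proof. by rewrite /ps_mul !big_ord_recl big_ord0/= mul1r addr0. Qed.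

Lemma ps_quad_mulSS u w f n :
  ps_mul (ps_quad u w) f n.+2 = f n.+2 + u * f n.+1 + w * f n.
Proof.
rewrite /ps_mul !big_ord_recl/= mul1r subn0 big1 ?addr0 ?addrA => [|i _].
  by rewrite /bump/= ?subSS ?subn0.
by rewrite mul0r.
Qed.

Definition ps_quadE := (ps_quad_mul0, ps_quad_mul1, ps_quad_mulSS).

Lemma ps_scale_quad c u w :
  ps_scale c (ps_quad u w) = ps_quad (c * u) (c ^+ 2 * w).
Proof. by apply/funext => -[|[|[|n]]]; rewrite /ps_scale/= ?mul1r ?mulr0. Qed.

Lemma ps_quad_geom u w :
  ps_mul (ps_quad (- (u + w)) (u * w)) (ps_mul (ps_geom u) (ps_geom w))
  = ps_one R.
Proof.
have lin c : ps_mul (ps_quad (- c) 0) (ps_geom c) = ps_one R.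
  apply/funext => -[|[|n]]; rewrite ps_quadE /ps_geom /ps_one/= ?expr1 ?expr0 ?mulr1 ?subrr//.
  by rewrite mul0r addr0 exprS mulNr subrr.
have -> : ps_quad (- (u + w)) (u * w) =
    ps_mul (ps_quad (- u) 0) (ps_quad (- w) 0).
  by apply/funext => -[|[|[|[|n]]]]; rewrite ps_quadE/= ?mulr0 ?mul0r ?addr0; ring.
rewrite [ps_mul (ps_geom u) _]ps_mulC -ps_mulA [X in ps_mul _ X]ps_mulA.
by rewrite lin ps_mul1 lin.
Qed.

(* Logarithmic derivative of (1 - u x)(1 - w x). *)
Definition ps_dlog u w : ps R := fun k => if k is 0 then 0 else - (u ^+ k + w ^+ k).

Lemma ps_theta_quad u w :
  ps_theta (ps_quad (- (u + w)) (u * w)) =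
  ps_mul (ps_dlog u w) (ps_quad (- (u + w)) (u * w)).
Proof.
rewrite ps_mulC; apply/funext => -[|[|[|n]]]; rewrite ps_quadE /ps_theta/=.
- by rewrite mul0r.
- by rewrite mul1r mulr0 addr0 !expr1.
- by rewrite mulr0; ring.
- by rewrite mulr0 !exprS; ring.
Qed.

(** A series without constant term has m-th power of order at least m, so the finite sum in [ps_exp]
    may be lengthened freely. *)
Lemma ps_pow_lt f m n : f 0%N = 0 -> (n < m)%N -> ps_pow f m n = 0.
Proof.
move=> f0; elim: m n => [|m IH] n //= nm; rewrite /ps_mul big1// => i _.
have [im|mi] := ltnP i m; first by rewrite IH ?mul0r.
by rewrite (_ : (n - i = 0)%N) ?f0 ?mulr0//; have := ltn_ord i; lia.
Qed.

Lemma ps_theta_pow f m :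
  ps_theta (ps_pow f m.+1) =
  (fun n => m.+1%:R * ps_mul (ps_pow f m) (ps_theta f) n).
Proof.
elim: m => [|m IH].
  by rewrite /= !ps_mul1; apply/funext => n; rewrite mul1r.
rewrite [ps_pow f m.+2]/= ps_thetaM IH ps_mulZl; apply/funext => n.
rewrite -ps_mulA (ps_mulC (ps_theta f)) ps_mulA [in RHS]/=.
by rewrite -[m.+2]addn1 natrD mulrDl mul1r.
Qed.

End PowerSeries.

(** * Exponentials and logarithmic derivatives *)

Lemma ps_theta_exp (R : numFieldType) (f : ps R) : f 0%N = 0 ->
  ps_theta (ps_exp f) = ps_mul (ps_theta f) (ps_exp f).
Proof.
move=> f0; apply/funext => n; rewrite ps_mulC /ps_theta [in LHS]/ps_exp mulr_sumr.
rewrite big_ord_recl/=.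
have -> : n%:R * ((0`!)%:R^-1 * ps_one R n) = 0.
  by rewrite /ps_one; case: n => [|n] /=; rewrite ?mul0r ?mulr0.
rewrite add0r [RHS]big_ord_recr/= subnn f0 !mulr0 addr0.
under eq_bigr => m _.
  rewrite mulrCA -[_ * ps_mul _ _ n]/(ps_theta (ps_pow f m.+1) n) ps_theta_pow.
  rewrite factS mulnC natrM invfM -mulrA mulKf ?pnatr_eq0//.
  rewrite /ps_mul big_ord_recr/= subnn [ps_theta f 0]mul0r mulr0 addr0 mulr_sumr.
  over.
rewrite exchange_big/=; apply: eq_bigr => i _.
rewrite /ps_exp.
under eq_bigr do rewrite mulrA.
rewrite -mulr_suml; congr (_ * _).
(* The exponential coefficient at i stops at m = i, whereas the left side runs over all m < n; the
   extra terms vanish by [ps_pow_lt]. *)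
rewrite [RHS](big_ord_widen n (fun m => (m`!%:R)^-1 * ps_pow f m i)) ?ltn_ord//.
rewrite [RHS]big_mkcond/=; apply: eq_bigr => m _; case: ifPn => //.
by rewrite -ltnNge => im; rewrite ps_pow_lt ?mulr0.
Qed.

(** Since M has no constant term, (n+1) f_(n+1) is determined by f_0, ..., f_n. *)
Lemma ps_theta_unique (R : numFieldType) (M f g : ps R) :
  M 0%N = 0 -> f 0%N = g 0%N ->
  ps_theta f = ps_mul M f -> ps_theta g = ps_mul M g -> f = g.
Proof.
move=> M0 fg0 fE gE; apply/funext; elim/ltn_ind => -[//|n] IH.
apply: (@mulfI _ n.+1%:R); first by rewrite pnatr_eq0.
have := congr1 (@^~ n.+1) fE; have := congr1 (@^~ n.+1) gE; rewrite /ps_theta => -> ->.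
rewrite /ps_mul big_ord_recl [RHS]big_ord_recl/= M0 !mul0r; congr (_ + _); apply: eq_bigr => i _.
by rewrite IH// subSS ltnS leq_subr.
Qed.

Lemma ps_theta_log_mul (R : comNzRingType) (M N f g : ps R) :
  ps_theta f = ps_mul M f -> ps_theta g = ps_mul N g ->
  ps_theta (ps_mul f g) = ps_mul (fun n => M n + N n) (ps_mul f g).
Proof.
move=> fE gE; rewrite ps_thetaM ps_mulDl fE gE; apply/funext => n.
by rewrite -ps_mulA; congr (_ + _); rewrite ps_mulA (ps_mulC f) -ps_mulA.
Qed.

(** * The q-difference equation and its solutions *)

(* The relation f(Qx) / f(x) = (1 - a x + Q x^2) / ((1 - x)(1 - Q x)). *)
Definition qdiff_eq (R : comNzRingType) (Q a : R) (f : ps R) :=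
  ps_mul (ps_quad (- (1 + Q)) Q) (ps_scale Q f) = ps_mul (ps_quad (- a) Q) f.

Lemma qdiff_eqP (R : comNzRingType) (Q a : R) (f : ps R) :
  qdiff_eq Q a f <->
  (Q - 1) * f 1 = (Q + 1 - a) * f 0 /\
  forall n, (Q ^+ n.+2 - 1) * f n.+2 =
            (Q ^+ n.+2 + Q ^+ n.+1 - a) * f n.+1 + (Q - Q ^+ n.+1) * f n.
Proof.
(* Each coefficient equation and its recurrence have the same difference of sides, which [ring] can
   check. *)
have eq_diff (x y z t : R) : x - y = z - t -> x = y -> z = t.
  by move=> /[swap] ->; rewrite subrr => /esym/eqP; rewrite subr_eq0 => /eqP.
split=> [fE|[f1 fn]].
  split=> [|n].
    by have := congr1 (@^~ 1) fE; apply: eq_diff; rewrite !ps_quadE /ps_scale; ring.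
  have := congr1 (@^~ n.+2) fE; apply: eq_diff; rewrite !ps_quadE /ps_scale !exprS.
  ring.
apply/funext => -[|[|n]]; rewrite !ps_quadE /ps_scale.
- by rewrite mul1r.
- by apply: eq_diff f1; ring.
- by apply: eq_diff (fn n); rewrite !exprS; ring.
Qed.

Lemma qdiff_eq_unique (R : idomainType) (Q a : R) (f g : ps R) :
  (forall n, Q ^+ n.+1 - 1 != 0) -> f 0 = g 0 ->
  qdiff_eq Q a f -> qdiff_eq Q a g -> f = g.
Proof.
move=> Q1 fg0 /qdiff_eqP[f1 fn] /qdiff_eqP[g1 gn].
apply/funext; elim/ltn_ind => -[//|n] IH; apply: (mulfI (Q1 n)).
by case: n IH => [|n] IH; rewrite ?expr1 ?f1 ?g1 ?fg0 // fn gn !IH.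
Qed.

(** Carries the equation from the real beta invariants to the complex field containing w1 and w2. *)
Lemma qdiff_eq_map (R S : comNzRingType) (phi : {rmorphism R -> S}) (Q a : R) (f : ps R) :
  qdiff_eq Q a f -> qdiff_eq (phi Q) (phi a) (fun n => phi (f n)).
Proof.
move=> /qdiff_eqP[f1 fn]; apply/qdiff_eqP; split=> [|n].
  by have := congr1 phi f1; rewrite !(rmorphM, rmorphB, rmorphD, rmorph1).
by have := congr1 phi (fn n); rewrite !(rmorphM, rmorphB, rmorphD, rmorphXn, rmorph1).
Qed.

Lemma qdiff_eq_exp (R : numFieldType) (Q w1 w2 : R) (L : ps R) :
  L 0%N = 0 -> w1 * w2 = Q ->
  (forall k, (Q ^+ k.+1 - 1) * (k.+1%:R * L k.+1) =
             Q ^+ k.+1 + 1 - w1 ^+ k.+1 - w2 ^+ k.+1) ->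
  qdiff_eq Q (w1 + w2) (ps_exp L).
Proof.
move=> L0 w12 LE; rewrite /qdiff_eq; have thE := ps_theta_exp L0.
apply: (@ps_theta_unique _ (fun k => ps_dlog w1 w2 k + ps_theta L k)).
- by rewrite /= /ps_theta mul0r addr0.
- by rewrite !ps_quadE /ps_scale mul1r.
(* The two logarithmic derivatives agree: coefficientwise this is the hypothesis [LE]. *)
- have -> : (fun k => ps_dlog w1 w2 k + ps_theta L k) =
      (fun k => ps_dlog 1 Q k + ps_scale Q (ps_theta L) k).
    apply/funext => -[|k]; rewrite /ps_theta /ps_scale/= ?mul0r ?mulr0 ?addr0//.
    have := LE k; rewrite expr1n mulrBl mul1r => /eqP; rewrite subr_eq => /eqP ->.
    by ring.
  apply: ps_theta_log_mul.
    by have := ps_theta_quad 1 Q; rewrite mul1r.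
  by rewrite ps_theta_scale thE ps_scaleM.
- apply: ps_theta_log_mul; last exact: thE.
  by rewrite -w12 ps_theta_quad.
Qed.

(** * Iteration of the equation and convergence of the product *)

Section Limit.
Variables (R : realType) (Q a : R) (f : ps R).
Hypotheses (Q_gt1 : 1 < Q) (f0 : f 0%N = 1) (fE : qdiff_eq Q a f).

Lemma qdiff_eq_factor K :
  ps_scale ((Q ^+ K)^-1) f =
  ps_mul (prod_factor Q a K.+1) (ps_scale ((Q ^+ K.+1)^-1) f).
Proof.
set c := (Q ^+ K.+1)^-1.
have Q0 : Q != 0 by rewrite gt_eqF// (lt_trans ltr01).
have cE : (Q ^+ K)^-1 = c * Q by rewrite /c exprS invfM mulrC mulVKf.
have := congr1 (ps_scale c) fE; rewrite !ps_scaleM !ps_scale_quad.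
have -> : ps_scale c (ps_scale Q f) = ps_scale (c * Q) f.
  by apply/funext => n; rewrite /ps_scale mulrA exprMn.
have -> : c * - (1 + Q) = - (c + Q * c) by ring.
have -> : c ^+ 2 * Q = c * (Q * c) by ring.
move=> /(congr1 (ps_mul (ps_mul (ps_geom c) (ps_geom (Q * c))))).
rewrite ps_mulA (ps_mulC (ps_mul _ _) (ps_quad _ _)) ps_quad_geom ps_mul1 cE => ->.
rewrite ps_mulA; congr ps_mul; rewrite ps_mulC /prod_factor -/c mulrN mulrC.
by congr (ps_mul (ps_quad _ _) _); rewrite mulnC exprM -exprVn -/c; ring.
Qed.

Lemma qdiff_eq_partial_prod K :
  f = ps_mul (partial_prod Q a K) (ps_scale ((Q ^+ K)^-1) f).
Proof.
elim: K => [|K IH] /=; last by rewrite -ps_mulA -qdiff_eq_factor.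
by rewrite ps_mul1; apply/funext => n; rewrite /ps_scale expr0 invr1 expr1n mul1r.
Qed.

(** In f(x) = P_K(x) f(Q^-K x) the x^n coefficient of P_K appears with factor f_0 = 1; every other
    term pairs a lower coefficient of P_K, convergent by induction, with Q^-(K(n-i)), which tends to
    0. *)
Lemma partial_prod_cvg n : (fun K => partial_prod Q a K n) @ \oo --> f n.
Proof.
elim/ltn_ind: n => n IH.
have -> : (fun K => partial_prod Q a K n) = (fun K => f n -
   \sum_(i < n) partial_prod Q a K i * ((Q ^- (n - i)) ^+ K * f (n - i)%N)).
  apply/funext => K; rewrite [in f n](qdiff_eq_partial_prod K) /ps_mul big_ord_recr/=.
  rewrite subnn /ps_scale expr0 mul1r f0 mulr1 addrAC.
  rewrite [X in X + _](_ : _ = 0) ?add0r//; apply/eqP; rewrite subr_eq0; apply/eqP.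
  by apply: eq_bigr => i _; rewrite -!exprVn -!exprM mulnC.
(* The limit 0 is spelled as a sum of products so that convergence can be checked factor by
   factor. *)
have S0 : \sum_(i < n) f i * (0 * f (n - i)%N) = 0.
  by rewrite big1// => i _; rewrite mul0r mulr0.
have addr_continuous : continuous (fun x : R * R => x.1 + x.2).
  by move=> x; apply: add_continuous.
rewrite -[X in _ --> X]subr0 -[X in _ --> _ - X]S0; apply: cvgB; first exact: cvg_cst.
apply: (cvg_big addr_continuous) => i _.
apply: cvgM; first exact: IH.
apply: cvgM; last exact: cvg_cst.
apply: cvg_expr.
rewrite ger0_norm ?invr_ge0 ?exprn_ge0 ?(ltW (lt_trans ltr01 Q_gt1))//.
by rewrite invf_lt1 ?exprn_gt0 ?(lt_trans ltr01)// exprn_egt1// subn_eq0 -ltnNge.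
Qed.

End Limit.

(** * Both descriptions of the beta invariants *)

Theorem theorem3p4 (R : realType) (q : nat) (ns : seq nat) (a : R)
    (w1 w2 : R[i]) :
  prime_power q ->
  all (fun n => (0 < n)%N) ns ->
  let Q : R := (q ^ (\prod_(n <- ns) n))%N%:R in
  ('X ^+ 2 - ((a%:C)%C)%:P * 'X + ((Q%:C)%C)%:P = ('X - w1%:P) * ('X - w2%:P)
     :> {poly R[i]}) ->
  (forall n : nat,
      (fun K : nat => partial_prod Q a K n) @ \oo --> beta_star Q a n)
  /\ (forall n : nat, ((beta_star Q a n)%:C)%C = b_coeff Q w1 w2 n).
Proof.
move=> [p [e [p_prime e_gt0 ->]]] ns_gt0 Q wE.
have Q_gt1 : 1 < Q.
  have k_gt0 : (0 < e * \prod_(n <- ns) n)%N.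
    rewrite muln_gt0 e_gt0/=; elim: ns ns_gt0 {Q wE} => [|n ns IH] /=.
      by rewrite big_nil.
    by move=> /andP[n0 /IH]; rewrite big_cons muln_gt0 n0.
  have := ltn_exp2r 1 p k_gt0.
  by rewrite exp1n (prime_gt1 p_prime) /Q -expnM ltr1n => ->.
have w_mul : w1 * w2 = (Q%:C)%C.
  have := congr1 (fun P => P.[0]) wE; rewrite !hornerE/= => E.
  by rewrite -mulrNN -E; ring.
(* Evaluation at 1 gives 1 - a + Q = (1 - w1)(1 - w2), from which the sum of the roots follows. *)
have w_add : w1 + w2 = (a%:C)%C.
  have := congr1 (fun P => P.[1]) wE; rewrite !hornerE/= => E.
  transitivity (1 + w1 * w2 - (1 - w1) * (1 - w2)); first by ring.
  by rewrite -E w_mul; ring.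
have betaE : qdiff_eq Q a (beta_star Q a).
  apply/qdiff_eqP; split; first by rewrite mulrC beta_star1 // beta_star0 mulr1.
  exact: beta_star_rec.
split=> [n|]; first exact: partial_prod_cvg.
pose C := @real_complex R.
have C_Q1 n : C Q ^+ n.+1 - 1 != 0.
  rewrite -rmorphXn -(rmorph1 C) -rmorphB fmorph_eq0 subr_eq0.
  by rewrite gt_eqF// exprn_egt1.
have betaCE : qdiff_eq (C Q) (C a) (fun n => C (beta_star Q a n)).
  exact: (qdiff_eq_map (real_complex R)).
have expE : qdiff_eq (C Q) (C a) (b_coeff Q w1 w2).
  rewrite -[C a]w_add; apply: qdiff_eq_exp => // k.
  rewrite /log_series/= /N_k -/C; field.
  by rewrite C_Q1 nat1r pnatr_eq0.
(* Both series solve the same equation, and both have constant term 1. *)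
by move=> n; apply: (congr1 (@^~ n) (qdiff_eq_unique C_Q1 _ betaCE expE)); rewrite
  /C rmorph1 /b_coeff /ps_exp big_ord1 /= invr1 mul1r.
Qed.
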